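(* Let $\Omega$ be a Lempert domain (in $\mathbb{C}^n$ for some $n\ge 1$). If there is a holomorphic map $\Phi:\Omega\to\mathbb{D}$ such that the one-element set $\{\Phi\}$ is a universal set for the Carathéodory extremal problem on $\Omega$, then $\Omega$ is isomorphic (that is, biholomorphically equivalent) to $\mathbb{D}$.
   Context: $\mathbb{D}$ is the open unit disc in $\mathbb{C}$. A domain is a connected (nonempty) open set in $\mathbb{C}^n$ for some integer $n\ge 1$. Datums. A datum $\delta$ in an open set $U\subseteq\mathbb{C}^n$ is either discrete, $\delta=(s_1,s_2)$ with $s_1,s_2\in U$, or infinitesimal, $\delta=(s,v)$ with $s\in U$, $v\in\mathbb{C}^n$. It is degenerate if $s_1=s_2$ (discrete case) or $v=0$ (infinitesimal case), and nondegenerate otherwise. If $F:U\to\Omega$ is holomorphic, then $F(\delta)=(F(s_1),F(s_2))$ for discrete $\delta$ and $F(\delta)=(F(s),D_vF(s))$ for infinitesimal $\delta$, where $D_vF(s)=\lim_{z\to0}(F(s+zv)-F(s))/z$; $F(\delta)$ is a datum in $\Omega$ of the same type as $\delta$. For a datum in $\mathbb{D}$: $|(z_1,z_2)|=\tanh^{-1}\left|\frac{z_1-z_2}{1-\overline{z_2}z_1}\right|$ (discrete), $|(z,v)|=\frac{|v|}{1-|z|^2}$ (infinitesimal). Extremal problems. For a domain $U$ and a nondegenerate datum $\delta$ in $U$, $|\delta|_{\rm car}=\sup\{|F(\delta)|: F:U\to\mathbb{D}\text{ holomorphic}\}$, and $|\delta|_{\rm kob}=\inf |\zeta|$, the infimum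 being over all datums $\zeta$ in $\mathbb{D}$ for which there is a holomorphic $f:\mathbb{D}\to U$ with $f(\zeta)=\delta$. A holomorphic $C:U\to\mathbb{D}$ solves $\mathrm{Car}\,\delta$ if $|C(\delta)|=|\delta|_{\rm car}$. Universal set. A set $\mathcal{C}$ of holomorphic maps $U\to\mathbb{D}$ is a universal set for the Carathéodory extremal problem on $U$ if for every nondegenerate datum $\delta$ in $U$ (discrete or infinitesimal) some $C\in\mathcal{C}$ solves $\mathrm{Car}\,\delta$. Lempert domain. A domain $U$ in $\mathbb{C}^n$ is a Lempert domain if (1) $U$ is weakly hyperbolic, i.e. $|\delta|_{\rm car}>0$ for every nondegenerate datum $\delta$ in $U$; (2) $U$ is taut, i.e. the set of holomorphic maps $\mathbb{D}\to U$ is a normal family (every sequence has a subsequence that either converges locally uniformly to a holomorphic map $\mathbb{D}\to U$ or diverges compactly); and (3) $|\delta|_{\rm car}=|\delta|_{\rm kob}$ for every nondegenerate datum $\delta$ in $U$. *)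

(* Defs.v *)
From HB Require Import structures.
From mathcomp Require Export all_boot all_order all_algebra complex.
From mathcomp Require Export all_classical all_reals all_analysis.

Set Implicit Arguments.
Unset Strict Implicit.
Unset Printing Implicit Defensive.

Export Order.TTheory GRing.Theory Num.Theory numFieldNormedType.Exports.

Local Open Scope classical_set_scope.
Local Open Scope ring_scope.

(** Points of the complex plane are taken in [R[i]^o], the alias of [R[i]] that
    carries the normed [R[i]]-module structure; C^n (n >= 1) is
    ['rV[R[i]]_n.+1].  Every normed module below is over [R[i]], so that
    [differentiable] is complex (Frechet) differentiability and ['D_v] is the
    limit of difference quotients with a complex increment.

    A map defined on an open set [U] only is represented by a total function,
    whose values outside [U] are irrelevant. *)

Definition disc (R : realType) : set R[i]^o := [set z | `|z| < 1].
Arguments disc : clear implicits.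

Definition domain (R : realType) (V : normedModType R[i]) (U : set V) : Prop :=
  [/\ open U, connected U & U !=set0].

Definition holomorphic_map (R : realType) (V W : normedModType R[i])
    (U : set V) (U' : set W) (F : V -> W) : Prop :=
  (forall x, U x -> differentiable F x) /\ (forall x, U x -> U' (F x)).

Definition biholomorphic (R : realType) (V W : normedModType R[i])
    (U : set V) (U' : set W) : Prop :=
  exists (F : V -> W) (G : W -> V),
    [/\ holomorphic_map U U' F, holomorphic_map U' U G,
        forall x, U x -> G (F x) = x & forall y, U' y -> F (G y) = y].

Inductive datum (V : Type) : Type :=
  | Discrete of V & V
  | Infinitesimal of V & V.

Definition datum_in (V : Type) (U : set V) (delta : datum V) : Prop :=
  match delta with
  | Discrete s1 s2 => U s1 /\ U s2
  | Infinitesimal s _ => U s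
  end.

Definition nondegenerate (R : realType) (V : normedModType R[i])
    (delta : datum V) : Prop :=
  match delta with
  | Discrete s1 s2 => s1 <> s2
  | Infinitesimal _ v => v <> 0
  end.

Definition map_datum (R : realType) (V W : normedModType R[i])
    (F : V -> W) (delta : datum V) : datum W :=
  match delta with
  | Discrete s1 s2 => Discrete (F s1) (F s2)
  | Infinitesimal s v => Infinitesimal (F s) ('D_v F s)
  end.

(** The inverse hyperbolic tangent, for [-1 < x < 1]. *)
Definition artanh (R : realType) (x : R) : R := ln ((1 + x) / (1 - x)) / 2.

(** The modulus as an element of [R]; the MathComp norm [`|z|] lies in [R[i]]. *)
Definition modulus (R : realType) (z : R[i]) : R := complex.Re `|z|.

Definition mobius (R : realType) (z1 z2 : R[i]) : R[i] :=
  (z1 - z2) / (1 - z2^* * z1).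

(** The hyperbolic size |delta|, meaningful for a datum in the disc. *)
Definition datum_size (R : realType) (delta : datum R[i]^o) : R :=
  match delta with
  | Discrete z1 z2 => artanh (modulus (mobius z1 z2))
  | Infinitesimal z v => modulus v / (1 - modulus z ^+ 2)
  end.

Definition car (R : realType) (V : normedModType R[i]) (U : set V)
    (delta : datum V) : \bar R :=
  ereal_sup [set (datum_size (map_datum F delta))%:E
            | F in [set F : V -> R[i]^o | holomorphic_map U (disc R) F]].

(** The infimum is [+oo] when no analytic disc passes through [delta]. *)
Definition kob (R : realType) (V : normedModType R[i]) (U : set V)
    (delta : datum V) : \bar R :=
  ereal_inf [set (datum_size zeta)%:E
            | zeta in [set zeta : datum R[i]^o |
                datum_in (disc R) zeta /\
                exists f : R[i]^o -> V,
                  holomorphic_map (disc R) U f /\ map_datum f zeta = delta]].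

Definition solves_car (R : realType) (V : normedModType R[i]) (U : set V)
    (delta : datum V) (C : V -> R[i]^o) : Prop :=
  holomorphic_map U (disc R) C /\
  (datum_size (map_datum C delta))%:E = car U delta.

Definition universal_set (R : realType) (V : normedModType R[i]) (U : set V)
    (CC : set (V -> R[i]^o)) : Prop :=
  (forall C, CC C -> holomorphic_map U (disc R) C) /\
  (forall delta : datum V, datum_in U delta -> nondegenerate delta ->
     exists C, CC C /\ solves_car U delta C).

Definition weakly_hyperbolic (R : realType) (V : normedModType R[i])
    (U : set V) : Prop :=
  forall delta : datum V, datum_in U delta -> nondegenerate delta ->
    (0 < car U delta)%E.

Definition converges_locally_uniformly (R : realType)
    (V W : normedModType R[i]) (U : set V) (f : nat -> V -> W) (g : V -> W) :
    Prop :=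
  forall x, U x -> exists N : set V,
    nbhs x N /\ {uniform N `&` U, f @ \oo --> g}.

Definition diverges_compactly (R : realType) (V W : normedModType R[i])
    (U : set V) (U' : set W) (f : nat -> V -> W) : Prop :=
  forall (K : set V) (L : set W),
    compact K -> K `<=` U -> compact L -> L `<=` U' ->
    \forall j \near \oo, (f j @` K) `&` L = set0.

Definition normal_family (R : realType) (V W : normedModType R[i])
    (U : set V) (U' : set W) (FF : set (V -> W)) : Prop :=
  forall f : nat -> V -> W, (forall j, FF (f j)) ->
    exists k : nat -> nat, {homo k : i j / (i < j)%N} /\
      ((exists g, holomorphic_map U U' g /\
          converges_locally_uniformly U (f \o k) g) \/
       diverges_compactly U U' (f \o k)).

Definition taut (R : realType) (V : normedModType R[i]) (U : set V) : Prop :=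
  normal_family (disc R) U [set f | holomorphic_map (disc R) U f].

Definition lempert_domain (R : realType) (V : normedModType R[i])
    (U : set V) : Prop :=
  [/\ domain U, weakly_hyperbolic U, taut U &
      forall delta : datum V, datum_in U delta -> nondegenerate delta ->
        car U delta = kob U delta].

(* Main.v *)
(** Since |Phi(delta)| = |delta|_car > 0 for every nondegenerate delta, Phi is
    injective and its derivative at every point is injective, hence onto C.

    Phi is proper: if the points s_j satisfy |Phi(s_j)| <= c < 1, then
    car = kob provides analytic discs f_j with f_j(0) = s_0 and f_j(r_j) = s_j
    where 0 <= r_j <= d < 1, and tautness makes the s_j cluster in Omega.

    Phi is onto without any open mapping theorem: for w close to the range, properness
    yields a point s of Omega minimising |Phi(s) - w|, and if Phi(s) <> w one
    can move s along a vector v with D_v Phi(s) = w - Phi(s) and come closer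
    to w.  Properness also makes the inverse of Phi continuous, hence
    holomorphic because the derivatives of Phi are bijective. *)
Require Import Defs.
From mathcomp Require Import ring lra.

Set Implicit Arguments.
Unset Strict Implicit.
Unset Printing Implicit Defensive.

Local Open Scope classical_set_scope.
Local Open Scope ring_scope.

(** * The real-valued modulus and the pseudo-hyperbolic distance on the disc *)

Lemma modulusE (R : realType) (z : R[i]) : (modulus z)%:C%C = `|z|.
Proof. by rewrite /modulus normc_def. Qed.

Lemma modulus_ge0 (R : realType) (z : R[i]) : 0 <= modulus z.
Proof. by rewrite -lecR modulusE; exact: normr_ge0. Qed.

Lemma modulus_real (R : realType) (r : R) : 0 <= r -> modulus r%:C%C = r.
Proof.
by move=> r0; rewrite /modulus ger0_norm // lecR.
Qed.

Lemma modulus_lt (R : realType) (z : R[i]) (r : R) :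
  (modulus z < r) = (`|z| < r%:C%C).
Proof. by rewrite -modulusE ltcR. Qed.

Lemma modulus_le (R : realType) (z : R[i]) (r : R) :
  (modulus z <= r) = (`|z| <= r%:C%C).
Proof. by rewrite -modulusE lecR. Qed.

Lemma discE (R : realType) (z : R[i]) : disc R z <-> modulus z < 1.
Proof. by rewrite modulus_lt. Qed.

Lemma modulusD (R : realType) (z w : R[i]) :
  modulus (z + w) <= modulus z + modulus w.
Proof. by rewrite -lecR rmorphD /= !modulusE ler_normD. Qed.

Lemma modulusM (R : realType) (z w : R[i]) :
  modulus (z * w) = modulus z * modulus w.
Proof.
by have := modulusE (z * w); rewrite normrM -!modulusE -rmorphM /= => -[].
Qed.

Lemma modulusN (R : realType) (z : R[i]) : modulus (- z) = modulus z.
Proof. by rewrite /modulus normrN. Qed.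

Lemma modulusC (R : realType) (z : R[i]) : modulus z^* = modulus z.
Proof. by rewrite /modulus norm_conjC. Qed.

Lemma modulus0 (R : realType) : modulus (0 : R[i]) = 0.
Proof. by rewrite /modulus normr0. Qed.

Lemma modulus1 (R : realType) : modulus (1 : R[i]) = 1.
Proof. by rewrite /modulus normr1. Qed.

Lemma modulus_gt0 (R : realType) (z : R[i]) : (0 < modulus z) = (z != 0).
Proof. by rewrite -ltcR modulusE normr_gt0. Qed.

Lemma modulusV (R : realType) (z : R[i]) : modulus z^-1 = (modulus z)^-1.
Proof. by have := modulusE z^-1; rewrite normfV -modulusE -fmorphV => -[]. Qed.

Lemma sqr_modulus (R : realType) (z : R[i]) : (modulus z ^+ 2)%:C%C = z * z^*.
Proof. by rewrite rmorphXn /= modulusE normCK. Qed.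

Lemma mobius_den_neq0 (R : realType) (a b : R[i]) :
  modulus a < 1 -> modulus b < 1 -> 1 - b^* * a != 0.
Proof.
move=> a1 b1; rewrite subr_eq0; apply/eqP => /(congr1 (@modulus R)).
rewrite modulus1 modulusM modulusC => E.
have := modulus_ge0 a; have := modulus_ge0 b; nra.
Qed.

(** Expanding squared moduli as [z * z^*] turns this into a polynomial identity. It yields both that
    [mobius] stays in the disc and, below, a quantitative version of that fact. *)
Lemma one_minus_sqr_mobius (R : realType) (a b : R[i]) :
  modulus a < 1 -> modulus b < 1 ->
  1 - modulus (mobius a b) ^+ 2 =
  (1 - modulus a ^+ 2) * (1 - modulus b ^+ 2) / modulus (1 - b^* * a) ^+ 2.
Proof.
move=> a1 b1; have D := mobius_den_neq0 a1 b1.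
have D' : modulus (1 - b^* * a) ^+ 2 != 0.
  by rewrite expf_neq0 // gt_eqF // modulus_gt0.
apply: (mulIf D'); rewrite mulfVK // modulusM modulusV mulrBl mul1r exprMn exprVn.
rewrite mulfVK //; apply: (@complexI R).
have := sqr_modulus a; have := sqr_modulus b; have := sqr_modulus (a - b).
have := sqr_modulus (1 - b^* * a).
move: (modulus _ ^+ 2) (modulus _ ^+ 2) (modulus _ ^+ 2) (modulus _ ^+ 2).
move=> G E B A hG hE hB hA.
rewrite rmorphM !rmorphB rmorph1 /= hA hB hG hE !rmorphB rmorphM rmorph1 /= conjCK.
ring.
Qed.

Lemma modulus_mobius_lt1 (R : realType) (a b : R[i]) :
  modulus a < 1 -> modulus b < 1 -> modulus (mobius a b) < 1.
Proof.
move=> a1 b1; have E := one_minus_sqr_mobius a1 b1.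
suff : 0 < 1 - modulus (mobius a b) ^+ 2.
  by have := modulus_ge0 (mobius a b); nra.
rewrite E; apply: divr_gt0; first apply: mulr_gt0.
- by have := modulus_ge0 a; nra.
- by have := modulus_ge0 b; nra.
- by rewrite exprn_gt0 // modulus_gt0 mobius_den_neq0.
Qed.

Lemma modulus_mobiusC (R : realType) (a b : R[i]) :
  modulus (mobius a b) = modulus (mobius b a).
Proof.
rewrite /mobius !modulusM !modulusV -opprB modulusN; congr (_ / _).
by rewrite -modulusC rmorphB rmorphM rmorph1 /= conjCK mulrC.
Qed.

Lemma mobiusK (R : realType) (a b : R[i]) :
  modulus a < 1 -> modulus b < 1 -> mobius (mobius b a) (- a) = b.
Proof.
move=> a1 b1; have D := mobius_den_neq0 b1 a1.
have E : 1 - a^* * a != 0 by exact: mobius_den_neq0.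
rewrite /mobius rmorphN /= opprK.
have -> : 1 - - a^* * ((b - a) / (1 - a^* * b)) =
          (1 - a^* * a) / (1 - a^* * b) by field.
by field; rewrite D E.
Qed.

Lemma mobius0 (R : realType) (a : R[i]) : mobius 0 (- a) = a.
Proof. by rewrite /mobius mulr0 subr0 divr1 sub0r opprK. Qed.

Lemma modulus_mobius_bound (R : realType) (a : R[i]) (c : R) :
  modulus a < 1 -> 0 <= c < 1 ->
  exists2 d : R, 0 <= d < 1 & forall b, modulus b <= c -> modulus (mobius a b) < d.
Proof.
move=> a1 /andP[c0 c1].
(* The denominator [1 - b^* * a] has modulus at most 2, so [q] bounds
   [1 - modulus (mobius a b) ^+ 2] from below uniformly in [b]. *)
pose q := (1 - modulus a ^+ 2) * (1 - c ^+ 2) / 4.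
have q0 : 0 < q.
  rewrite divr_gt0 // mulr_gt0 //; last by nra.
  by have := modulus_ge0 a; nra.
have q1 : q <= 1.
  rewrite ler_pdivrMr // mul1r; apply: (@le_trans _ _ 1); last lra.
  by apply: mulr_ile1; have := modulus_ge0 a; nra.
(* The square of [1 - q / 2] is [1 - q + q ^+ 2 / 4], which exceeds [1 - q]. *)
exists (1 - q / 2); first by apply/andP; split; nra.
move=> b bc; have b1 := le_lt_trans bc c1.
have E := one_minus_sqr_mobius a1 b1.
suff : q <= 1 - modulus (mobius a b) ^+ 2.
  by have := modulus_ge0 (mobius a b); nra.
rewrite {}E /q.
have D := mobius_den_neq0 a1 b1.
have D2 : modulus (1 - b^* * a) <= 2.
  apply: le_trans (modulusD _ _) _.
  rewrite modulus1 modulusN modulusM modulusC.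
  by have := modulus_ge0 a; have := modulus_ge0 b; nra.
rewrite -modulus_gt0 in D.
apply: ler_pM.
- by apply: mulr_ge0; have := modulus_ge0 a; nra.
- by rewrite invr_ge0.
- by apply: ler_pM; have := modulus_ge0 a; have := modulus_ge0 b; nra.
- rewrite lef_pV2 ?posrE ?exprn_gt0 //; nra.
Qed.

(** * Analytic discs through two points *)

Lemma ltr_artanh (R : realType) (x y : R) :
  0 <= x < 1 -> 0 <= y < 1 -> (artanh x < artanh y) = (x < y).
Proof.
move=> /andP[x0 x1] /andP[y0 y1].
rewrite /artanh ltr_pM2r // ltr_ln ?posrE; last 2 first.
- by rewrite divr_gt0 //; lra.
- by rewrite divr_gt0 //; lra.
rewrite ltr_pdivrMr; last by lra.
rewrite mulrAC ltr_pdivlMr; last by lra.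
by apply/idP/idP; nra.
Qed.

Lemma artanh0 (R : realType) : artanh (0 : R) = 0.
Proof. by rewrite /artanh addr0 subr0 divr1 ln1 mul0r. Qed.

Lemma holomorphic_mobius_rotation (R : realType) (a u : R[i]) :
  modulus a < 1 -> modulus u <= 1 ->
  holomorphic_map (disc R) (disc R)
    (fun z : R[i]^o => mobius (u * z) (- a) : R[i]^o).
Proof.
move=> a1 u1.
have uz (z : R[i]) : disc R z -> modulus (u * z) < 1.
  move/discE => z1; rewrite modulusM.
  by have := modulus_ge0 u; have := modulus_ge0 z; nra.
have Na : modulus (- a) < 1 by rewrite modulusN.
split=> z /uz z1; last by apply/discE/modulus_mobius_lt1.
rewrite /mobius; apply: differentiableM.
  apply: differentiableB; last exact: differentiable_cst.
  apply: differentiableM; first exact: differentiable_cst.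
  exact: ex_diff.
apply: differentiableV; last exact: mobius_den_neq0.
apply: differentiableB; first exact: differentiable_cst.
apply: differentiableM; first exact: differentiable_cst.
apply: differentiableM; first exact: differentiable_cst.
exact: ex_diff.
Qed.

Lemma holomorphic_comp (R : realType) (U V W : normedModType R[i])
    (A : set U) (B : set V) (C : set W) (f : U -> V) (g : V -> W) :
  holomorphic_map A B f -> holomorphic_map B C g -> holomorphic_map A C (g \o f).
Proof.
move=> [df fAB] [dg gBC]; split=> x Ax; last exact/gBC/fAB.
by apply: differentiable_comp; [exact: df | exact/dg/fAB].
Qed.

(* Precomposing with a disc automorphism moves the datum (z1, z2) to (0, r). *)
Lemma disc_normalisation (R : realType) (V : normedModType R[i])
    (Omega : set V) (f : R[i]^o -> V) (z1 z2 : R[i]) :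
  holomorphic_map (disc R) Omega f -> disc R z1 -> disc R z2 ->
  exists g : R[i]^o -> V, [/\ holomorphic_map (disc R) Omega g, g 0 = f z1 &
    g (modulus (mobius z1 z2))%:C%C = f z2].
Proof.
move=> hf /discE z11 /discE z21; set r := modulus _.
(* [u] is the phase of [mobius z2 z1]. If [z1 = z2] there is no phase; [u = 0] then makes the new
   disc constant, which is why only [modulus u <= 1] is asked for. *)
have [u u1 ur] : exists2 u : R[i], modulus u <= 1 & u * r%:C%C = mobius z2 z1.
  have [r0|r0] := eqVneq r 0.
    exists 0; first by rewrite modulus0.
    rewrite mul0r; apply/esym/eqP; rewrite -[_ == _]negbK -modulus_gt0.
    by rewrite modulus_mobiusC -/r r0 ltxx.
  have rC0 : r%:C%C != 0 :> R[i] by rewrite fmorph_eq0.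
  exists (mobius z2 z1 / r%:C%C); last by rewrite mulfVK.
  by rewrite modulusM modulusV modulus_real ?modulus_ge0 // modulus_mobiusC divff.
exists (f \o (fun z : R[i]^o => mobius (u * z) (- z1) : R[i]^o)); split.
- exact: holomorphic_comp (holomorphic_mobius_rotation z11 u1) hf.
- by rewrite /= mulr0 mobius0.
- by rewrite /= ur mobiusK.
Qed.

(** Universality computes the Carathéodory size of the pair from the two values of [Phi], hence
    bounds it below [artanh d]. The Kobayashi infimum has the same bound, so some disc realises the
    pair with a smaller size. The point is that [d] does not depend on [s]. *)
Lemma disc_through (R : realType) (V : normedModType R[i]) (Omega : set V)
    (Phi : V -> R[i]^o) (s0 : V) (c : R) :
  (forall delta : datum V, datum_in Omega delta -> nondegenerate delta ->
      car Omega delta = kob Omega delta) ->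
  universal_set Omega [set Phi] -> Omega s0 -> 0 <= c < 1 ->
  exists2 d : R, 0 <= d < 1 &
    forall s, Omega s -> modulus (Phi s) <= c ->
    exists (f : R[i]^o -> V) (r : R),
      [/\ holomorphic_map (disc R) Omega f, 0 <= r <= d, f 0 = s0 & f r%:C%C = s].
Proof.
move=> carkob [PhiD univ] Os0 c01.
have hPhi : holomorphic_map Omega (disc R) Phi by exact: PhiD.
have P0 : modulus (Phi s0) < 1 by apply/discE/hPhi.2.
have [d d01 dP] := modulus_mobius_bound P0 c01.
exists d => // s Os Psc.
(* Equality of [car] and [kob] is available for nondegenerate data only; for [s = s0] a constant
   disc serves. *)
have [<-|/eqP s0s] := eqVneq s0 s.
  exists (cst s0), 0; split=> //; by rewrite lexx; case/andP: d01.
have [C [/= -> [_ sC]]] := univ (Discrete s0 s) (conj Os0 Os) s0s.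
have : (kob Omega (Discrete s0 s) < (artanh d)%:E)%E.
  by rewrite -carkob // -sC lte_fin /= ltr_artanh ?dP ?modulus_ge0 ?modulus_mobius_lt1 //;
    apply/discE/hPhi.2.
move=> /ereal_inf_lt[_ [zeta [zetaD [f [hf fz]]] <-]].
(* Maps preserve the type of a datum, so [zeta] is discrete. *)
case: zeta zetaD fz => // z1 z2 [z1D z2D] /= [fz1 fz2].
rewrite lte_fin ltr_artanh //; last first.
  by rewrite modulus_ge0 modulus_mobius_lt1 //; exact/discE.
move=> lt_d; have [g [hg g0 gr]] := disc_normalisation hf z1D z2D.
exists g, (modulus (mobius z1 z2)); split=> //.
- by rewrite modulus_ge0 ltW.
- by rewrite g0.
- by rewrite gr.
Qed.

(** * Properness of [Phi] *)

Lemma gt0_complex (R : realType) (e : R[i]) :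
  0 < e -> exists2 d : R, 0 < d & e = d%:C%C.
Proof.
move=> e0; exists (modulus e); first by rewrite modulus_gt0 gt_eqF.
by rewrite modulusE gtr0_norm.
Qed.

Lemma continuous_real_complex (R : realType) :
  continuous (fun x : R => x%:C%C : R[i]^o).
Proof.
move=> x; apply/cvgrPdist_lt => _ /gt0_complex[e e0 ->].
have : \forall t \near x, `|x - t| < e by exact: (@cvgr_dist_lt _ _ _ (nbhs x) _ id).
apply: filterS => t xt.
by rewrite -rmorphB /= normc_def /= expr0n /= addr0 sqrtr_sqr ltcR.
Qed.

Lemma homo_lt_geq_id (k : nat -> nat) :
  {homo k : i j / (i < j)%N} -> forall j, (j <= k j)%N.
Proof. by move=> kP; elim=> // j IH; apply: leq_ltn_trans IH (kP _ _ _). Qed.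

(** Discs through [s 0] and [s j] have a locally uniform limit [g] along a subsequence, and their
    parameters cluster at some [r] with [r <= d < 1]; the point sought is [g r]. *)
Lemma proper_cluster (R : realType) (V : normedModType R[i]) (Omega : set V)
    (Phi : V -> R[i]^o) (s : nat -> V) (c : R) :
  (forall delta : datum V, datum_in Omega delta -> nondegenerate delta ->
      car Omega delta = kob Omega delta) ->
  taut Omega -> universal_set Omega [set Phi] -> 0 <= c < 1 ->
  (forall j, Omega (s j)) -> (forall j, modulus (Phi (s j)) <= c) ->
  exists2 p, Omega p & cluster (s @ \oo) p.
Proof.
move=> carkob tautO univ c01 Os sc.
have [d /andP[d0 d1] dP] := disc_through carkob univ (Os 0%N) c01.
have /choice[F FP] : forall j, exists fr : (R[i]^o -> V) * R,
    [/\ holomorphic_map (disc R) Omega fr.1, 0 <= fr.2 <= d, fr.1 0 = s 0%N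
      & fr.1 fr.2%:C%C = s j].
  by move=> j; have [f [r P]] := dP _ (Os j) (sc j); exists (f, r).
have [k [kP]] := tautO (fun j => (F j).1) (fun j => let: And4 h _ _ _ := FP j in h).
have kge := homo_lt_geq_id kP.
(* All discs send 0 to [s 0], so the compact sets [[set 0]] and [[set s 0]] rule out compact
   divergence. *)
case=> [[g [[dg gO] gcvg]]|div]; last first.
  have [||||N _ /(_ N (leqnn _)) /=] := div [set 0] [set s 0%N].
  - exact: compact_set1.
  - by move=> _ ->; apply/discE; rewrite modulus0.
  - exact: compact_set1.
  - by move=> _ ->; exact: Os.
  move/seteqP => [/(_ (s 0%N)) /= []]; split=> //.
  by exists 0 => //; have [] := FP (k N).
have [|r [/=]] := @segment_compact R 0 d ((fun j => (F (k j)).2) @ \oo) _.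
  by exists 0%N => // j _ /=; rewrite in_itv /=; have [] := FP (k j).
rewrite in_itv /= => /andP[r0 rd] clr.
have rD : disc R r%:C%C by apply/discE; rewrite modulus_real // (le_lt_trans rd).
exists (g r%:C%C); first exact: gO.
have [N [rN gN]] := gcvg _ rD.
move=> A B sA /nbhs_normP[e /= e0 eB].
have e20 : 0 < e / 2 by rewrite divr_gt0.
have near_r : nbhs (r : R) [set t : R | N t%:C%C /\ `|g r%:C%C - g t%:C%C| < e / 2].
  have gc : {for r%:C%C, continuous g}.
    by apply: differentiable_continuous; exact: dg.
  have Q : nbhs (r%:C%C : R[i]^o) [set z | N z /\ `|g r%:C%C - g z| < e / 2].
    by apply: filterI => //; move/cvgrPdist_lt : gc; exact.
  exact: (@continuous_real_complex R r _ Q).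
have unif : \forall j \near \oo, forall z, N z -> disc R z ->
    `|g z - (F (k j)).1 z| < e / 2.
  have entE : entourage [set xy : V * V | `|xy.1 - xy.2| < e / 2].
    by rewrite -entourage_ballE; exists (e / 2) => //= xy; rewrite -ball_normE.
  have /gN : nbhs (g : {uniform` N `&` disc R -> V})
      [set h | forall z, (N `&` disc R) z -> `|g z - h z| < e / 2].
    by apply/uniform_nbhs; exists [set xy : V * V | `|xy.1 - xy.2| < e / 2]; split.
  by move=> [M _ MP]; exists M => // j Mj z Nz Dz; exact: (MP j Mj).
(* One index [j] serves twice: its parameter is close to [r], and its disc is uniformly close to
   [g]. Each contributes [e / 2] to the distance from [g r] to [s (k j)]. *)
have [_ [[j [jA ju] <-] [jN jg]]] : 
  [set (F (k j)).2 | j in [set j | A (s (k j)) /\ forall z, N z -> disc R z ->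
    `|g z - (F (k j)).1 z| < e / 2]] `&` 
  [set t : R | N t%:C%C /\ `|g r%:C%C - g t%:C%C| < e / 2] !=set0.
  apply: clr near_r.
  have [M _ MA] := sA; have [M' _ MU] := unif.
  exists (maxn M M') => // j; rewrite /= geq_max => /andP[Mj M'j].
  exists j => //=; split; last exact: MU.
  by apply: MA => /=; exact: leq_trans (kge j).
have [_ /andP[Fr0 Frd] _ Fs] := FP (k j).
exists (s (k j)); split=> //; apply: eB.
rewrite -Fs /= (splitr e).
rewrite -[_ - _](subrKA (g (F (k j)).2%:C%C)).
apply: le_lt_trans (ler_normD _ _) (ltrD jg (ju _ jN _)).
by apply/discE; rewrite modulus_real // (le_lt_trans Frd).
Qed.

(** * Surjectivity by minimising the distance to a target value *)

Lemma ge0_complex (R : realType) (e : R[i]) :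
  0 <= e -> exists2 d : R, 0 <= d & e = d%:C%C.
Proof.
move=> e0; exists (modulus e); first exact: modulus_ge0.
by rewrite modulusE ger0_norm.
Qed.

Lemma continuous_modulus (R : realType) : continuous (fun z : R[i]^o => modulus z).
Proof.
move=> z; apply/(@cvgrPdist_lt _ R^o _ (nbhs (z : R[i]^o)) (nbhs_filter _)) => e e0.
have : \forall t \near z, `|z - t| < e%:C%C.
  by apply: (@cvgr_dist_lt _ R[i]^o _ (nbhs (z : R[i]^o)) _ id) => //; rewrite ltcR.
apply: filterS => t; rewrite -modulus_lt; apply: le_lt_trans.
have h1 := modulusD (z - t) t; have h2 := modulusD (t - z) z.
rewrite !subrK in h1 h2; rewrite -(modulusN (t - z)) opprB in h2.
by rewrite ler_norml; lra.
Qed.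

Lemma cluster_cvg_eq (T U : topologicalType) (s : nat -> T) (f : T -> U)
    (p : T) (l : U) :
  hausdorff_space U -> cluster (s @ \oo) p -> {for p, continuous f} ->
  f (s j) @[j --> \oo] --> l -> f p = l.
Proof.
move=> hU clp cf fl; apply: hU => A B Ap Bl.
have [x [Bx Ax]] := clp (f @^-1` B) (f @^-1` A) (fl _ Bl) (cf _ Ap).
by exists (f x).
Qed.

(** To first order, moving [s] by [t v] moves the value by [t q] towards [w]. An error of at most
    [t |q| / 2] still leaves the distance at most [(1 - t / 2) |q|]. *)
Lemma derive_decrease (R : realType) (V : normedModType R[i]) (Omega : set V)
    (Phi : V -> R[i]^o) (s v : V) (w : R[i]) :
  open Omega -> Omega s -> differentiable Phi s -> 'D_v Phi s = w - Phi s ->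
  w != Phi s ->
  exists2 s', Omega s' & modulus (Phi s' - w) < modulus (Phi s - w).
Proof.
move=> oO Os dP; set q : R[i]^o := w - Phi s => Dq wq.
have q0 : q != 0 by rewrite subr_eq0.
have q20 : 0 < `|q| / 2 by rewrite divr_gt0 // normr_gt0.
have quot : \forall h \near (0 : R[i]^o)^',
    `|q - h^-1 *: (Phi (h *: v + s) - Phi s)| < `|q| / 2.
  have /cvgrPdist_lt : h^-1 *: (Phi (h *: v + s) - Phi s) @[h --> (0 : R[i]^o)^'] --> q.
    by rewrite -Dq; exact: (diff_derivable dP).
  exact.
have inO : \forall h \near (0 : R[i]^o), Omega (h *: v + s).
  have c : {for (0 : R[i]^o), continuous (fun h : R[i]^o => h *: v + s)}.
    by apply: differentiable_continuous; exact: differentiableD.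
  apply: c; rewrite scale0r add0r; exact: open_nbhs_nbhs.
have /nbhs_normP[_ /= /gt0_complex[d d0 ->] dQ] :
    \forall h \near (0 : R[i]^o), h != 0 -> Omega (h *: v + s) /\
       `|q - h^-1 *: (Phi (h *: v + s) - Phi s)| < `|q| / 2.
  move: quot; rewrite near_withinE => quot.
  near=> h => h0; split; first by near: h.
  by move: h0; near: h.
(* any real t with 0 < t < min d 1 *)
pose t := d / (d + 1).
have t0 : 0 < t by rewrite divr_gt0 //; lra.
have t1 : t < 1 by rewrite ltr_pdivrMr; lra.
have td : t < d by rewrite ltr_pdivrMr; nra.
have tC0 : t%:C%C != 0 :> R[i] by rewrite fmorph_eq0 gt_eqF.
have [|Os' qt] := dQ t%:C%C _ tC0.
  by rewrite /ball_ /= sub0r normrN -modulus_lt modulus_real // ltW.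
exists (t%:C%C *: v + s) => //; move: qt; set P' := Phi (_ + _) => qt.
have {}qt : modulus (q - t%:C%C^-1 * (P' - Phi s)) < modulus q / 2.
  rewrite modulus_lt; have -> // : (modulus q / 2)%:C%C = `|q| / 2.
  by rewrite (rmorphM (real_complex R)) (fmorphV (real_complex R)) rmorph_nat -modulusE.
have -> : P' - w = - ((1 - t)%:C%C * q + t%:C%C * (q - t%:C%C^-1 * (P' - Phi s))).
  by rewrite rmorphB rmorph1 /q; field.
have -> : Phi s - w = - q by rewrite opprB.
rewrite !modulusN; apply: le_lt_trans (modulusD _ _) _.
rewrite !modulusM !modulus_real; [|lra|lra].
by have := modulus_gt0 q; rewrite q0; nra.
Unshelve. all: by end_near. Qed.

(** Properness makes a minimising sequence for the distance to [w] cluster in [Omega], and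
    [derive_decrease] forbids a positive minimum. *)
Lemma value_near_value (R : realType) (V : normedModType R[i]) (Omega : set V)
    (Phi : V -> R[i]^o) (s0 : V) (w : R[i]) :
  open Omega -> (forall x, Omega x -> differentiable Phi x) ->
  (forall x, Omega x -> exists u, 'D_u Phi x = 1) ->
  (forall (s : nat -> V) (c : R), 0 <= c < 1 -> (forall j, Omega (s j)) ->
    (forall j, modulus (Phi (s j)) <= c) ->
    exists2 p, Omega p & cluster (s @ \oo) p) ->
  Omega s0 -> modulus w + modulus (Phi s0 - w) < 1 ->
  exists2 s, Omega s & Phi s = w.
Proof.
move=> oO dP unitD proper Os0; set rho := modulus (_ - w) => w1.
(* On this sublevel set [modulus (Phi s)] is at most [modulus w + rho < 1], as [proper] requires. *)
pose S := [set modulus (Phi s - w) | s in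
  [set s | Omega s /\ modulus (Phi s - w) <= rho]].
have hS : has_inf S.
  split; first by exists rho, s0.
  by exists 0 => _ [s _ <-]; exact: modulus_ge0.
have /choice[s sP] : forall j : nat, exists s, [/\ Omega s, modulus (Phi s - w) <= rho
    & modulus (Phi s - w) < inf S + j.+1%:R^-1].
  move=> j; have j0 : 0 < j.+1%:R^-1 :> R by rewrite invr_gt0.
  by have [_ [s [Os sr] <-] lt_s] := inf_adherent j0 hS; exists s.
have c01 : 0 <= modulus w + rho < 1 by rewrite w1 addr_ge0 ?modulus_ge0.
have [||p Op clp] := proper s _ c01.
- by move=> j; have [] := sP j.
- move=> j; have [_ sr _] := sP j; rewrite -[Phi _](subrK w) addrC.
  by apply: le_trans (modulusD _ _) _; rewrite lerD2l.
have pS : modulus (Phi p - w) = inf S.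
  apply: (cluster_cvg_eq (f := fun x => modulus (Phi x - w)) _ clp).
  - exact: norm_hausdorff.
  - apply: (@continuous_comp _ _ _ (fun x => Phi x - w : R[i]^o)
      (fun z : R[i]^o => modulus z)).
      apply: differentiable_continuous; apply: differentiableB => //; exact: dP.
    exact: continuous_modulus.
  - apply/cvgrPdist_lt => e e0.
    have [M _ MP] := near_infty_natSinv_lt (PosNum e0).
    exists M => // j /MP /= je; have [Osj sr lt_s] := sP j.
    rewrite distrC ger0_norm; last first.
      by rewrite subr_ge0; apply: ge_inf; [exact: hS.2|exists (s j)].
    by rewrite ltrBlDl (lt_trans lt_s) // ltrD2l.
exists p => //; apply/eqP/negPn/negP => pw.
have [u Du] := unitD _ Op.
have Dv : 'D_((w - Phi p) *: u) Phi p = w - Phi p.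
  rewrite deriveE; last exact: dP.
  by rewrite linearZ /= -deriveE ?Du; [exact: mulr1|exact: dP].
have wp : w != Phi p by rewrite eq_sym.
have [s' Os' lt_s'] := derive_decrease oO Op (dP _ Op) Dv wp.
have : inf S <= modulus (Phi s' - w).
  apply: ge_inf; first exact: hS.2.
  exists s' => //=; split=> //; apply: (le_trans (ltW lt_s')); rewrite pS.
  by apply: ge_inf; [exact: hS.2|exists s0].
by rewrite leNgt -pS lt_s'.
Qed.

(* The range is reached from a known value by short steps along a segment. *)
Lemma onto_disc (R : realType) (V : normedModType R[i]) (Omega : set V)
    (Phi : V -> R[i]^o) :
  Omega !=set0 -> (forall x, Omega x -> disc R (Phi x)) ->
  (forall s0 w, Omega s0 -> modulus w + modulus (Phi s0 - w) < 1 ->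
     exists2 s, Omega s & Phi s = w) ->
  forall w, disc R w -> exists2 s, Omega s & Phi s = w.
Proof.
move=> [s0 Os0] PD step w /discE w1; have /discE b1 := PD _ Os0.
set b := Phi s0 in b1.
(* By convexity [C] bounds the modulus along the whole segment from [b] to [w]; steps shorter than
   [1 - C] therefore meet the hypothesis of [step]. *)
pose C := Num.max (modulus b) (modulus w).
have C1 : C < 1 by rewrite gt_max b1.
have [bC wC] : modulus b <= C /\ modulus w <= C by rewrite !le_max !lexx orbT.
have [N lt_N] : exists N : nat, modulus (b - w) / (1 - C) < N.+1%:R.
  exists (Num.truncn (modulus (b - w) / (1 - C))); exact: truncnS_gt.
pose x (k : nat) : R := k%:R / N.+1%:R.
have walk k : (k <= N.+1)%N -> exists2 s, Omega s & Phi s = b + (x k)%:C%C * (w - b).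
  elim: k => [_|k IH kN]; first by exists s0; rewrite // /x mul0r mul0r addr0.
  have [s Os Ps] := IH (ltnW kN); apply: (step s) => //.
  have x0 : 0 <= x k.+1 by rewrite divr_ge0.
  have x1 : x k.+1 <= 1 by rewrite ler_pdivrMr // mul1r ler_nat.
  have xS : x k.+1 - x k = N.+1%:R^-1 by rewrite /x -mulrBl -natrB // subSnn mul1r.
  have -> : Phi s - (b + (x k.+1)%:C%C * (w - b)) = (x k.+1 - x k)%:C%C * (b - w).
    by rewrite Ps rmorphB /=; ring.
  have -> : b + (x k.+1)%:C%C * (w - b) = (1 - x k.+1)%:C%C * b + (x k.+1)%:C%C * w.
    by rewrite rmorphB rmorph1 /=; ring.
  apply: (@le_lt_trans _ _ (C + modulus (b - w) / N.+1%:R)); last first.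
    rewrite -ltrBrDl ltr_pdivrMr //; move: lt_N; rewrite ltr_pdivrMr; last lra.
    by rewrite mulrC.
  rewrite lerD //.
    apply: (le_trans (modulusD _ _)); rewrite !modulusM !modulus_real //; last lra.
    nra.
  by rewrite xS modulusM modulus_real ?invr_ge0 // mulrC.
have [s Os Ps] := walk _ (leqnn _).
by exists s => //; rewrite Ps /x divff // mul1r addrC subrK.
Qed.

(** * Continuity and differentiability of the inverse *)

(** Otherwise some [z j] tend to [w] while [g (z j)] stays away from [g w]. By properness these
    points cluster at some [p]; then [Phi p = w], and injectivity forces [p = g w]. *)
Lemma inverse_continuous (R : realType) (V : normedModType R[i])
    (Omega : set V) (Phi : V -> R[i]^o) (g : R[i]^o -> V) :
  (forall x, Omega x -> differentiable Phi x) ->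
  (forall x y, Omega x -> Omega y -> Phi x = Phi y -> x = y) ->
  (forall (s : nat -> V) (c : R), 0 <= c < 1 -> (forall j, Omega (s j)) ->
    (forall j, modulus (Phi (s j)) <= c) ->
    exists2 p, Omega p & cluster (s @ \oo) p) ->
  (forall z, disc R z -> Omega (g z)) ->
  (forall z, disc R z -> Phi (g z) = z) ->
  forall w, disc R w -> {for w, continuous g}.
Proof.
move=> dP inj proper gO Pg w wD.
apply/(@cvgrPdist_lt _ V _ (nbhs (w : R[i]^o)) (nbhs_filter _)) => e e0.
apply: contrapT => nnear.
have w1 : modulus w < 1 by exact/discE.
have w0 := modulus_ge0 w.
pose c := (1 + modulus w) / 2.
have c01 : 0 <= c < 1 by apply/andP; split; rewrite /c; lra.
have near_w (d : R) : 0 < d -> exists z, modulus (w - z) < d /\ ~ (`|g w - g z| < e).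
  move=> d0; apply: contrapT => nex; apply: nnear.
  apply: (@nbhs_norm_le_nbhs _ R[i]^o w).
  exists d%:C%C => /=; first by rewrite ltcR.
  move=> z; rewrite /ball_ /= -modulus_lt => wz; apply: contrapT => ge.
  by apply: nex; exists z.
(* The factor [c - modulus w] keeps every [z j] within radius [c], and it is at most 1, so the
   distances to [w] still tend to 0. *)
have /choice[z zP] : forall j : nat, exists z,
    modulus (w - z) < (c - modulus w) * j.+1%:R^-1 /\ ~ (`|g w - g z| < e).
  by move=> j; apply: near_w; rewrite mulr_gt0 ?invr_gt0 //; rewrite /c; lra.
have zc j : modulus (z j) <= c.
  have [lt_z _] := zP j; rewrite -[z j](subrK w); apply: (le_trans (modulusD _ _)).
  rewrite -modulusN opprB -lerBrDr; apply: (le_trans (ltW lt_z)).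
  by rewrite ler_piMr ?invf_le1 ?ler1n ?ltr0n //; rewrite /c; lra.
have zD j : disc R (z j) by apply/discE/(le_lt_trans (zc j)); case/andP: c01.
have [|j|p Op clp] := proper (g \o z) c c01.
- by move=> j; exact: gO.
- by rewrite /= Pg.
have Pp : Phi p = w.
  apply: (@cluster_cvg_eq V R[i]^o _ Phi p w) clp _ _.
  - exact: norm_hausdorff.
  - by apply: differentiable_continuous; exact: dP.
  - under eq_fun do rewrite /= Pg //.
    apply/cvgrPdist_lt => _ /gt0_complex[d d0 ->].
    have [M _ MP] := near_infty_natSinv_lt (PosNum d0).
    exists M => // j /MP /= jd; have [lt_z _] := zP j.
    rewrite -modulus_lt (lt_trans lt_z) // (le_lt_trans _ jd) //.
    by rewrite ler_piMl ?invr_ge0 //; rewrite /c; lra.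
have pgw : p = g w by apply: inj; rewrite ?Pg //; exact: gO.
have [_ [[j _ <-]] ] : range (g \o z) `&` [set x | `|g w - x| < e] !=set0.
  apply: clp; first by exists 0%N => // j _; exists j.
  by rewrite pgw; apply/nbhs_normP; exists e.
by have [_] := zP j.
Qed.

(** An injective differential with value 1 at [u] makes [u] span the space. The increment of [g] is
    thus a multiple of [u], and the expansion of [Phi] at [g w] determines the factor up to a small
    error. *)
Lemma inverse_differentiable (R : realType) (V : normedModType R[i])
    (Phi : V -> R[i]^o) (g : R[i]^o -> V) (w : R[i]^o) (u : V) :
  differentiable Phi (g w) -> {for w, continuous g} ->
  (\forall z \near w, Phi (g z) = z) ->
  'D_u Phi (g w) = 1 -> (forall x, 'D_x Phi (g w) = 0 -> x = 0) ->
  differentiable g w.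
Proof.
move=> dP gc gK Du Dinj.
have xLu x : x = 'd Phi (g w) x *: u.
  apply/eqP; rewrite -subr_eq0; apply/eqP/Dinj; rewrite deriveE //.
  rewrite linearB linearZ /= -(deriveE u) // Du.
  by rewrite -[_ *: 1]/(_ * 1) mulr1 subrr.
(* In one complex variable a limit of difference quotients is enough for differentiability. *)
suff qcvg : h^-1 *: (g (h *: (1 : R[i]^o) + w) - g w) @[h --> (0 : R[i]^o)^'] --> u.
  by apply/derivable1_diffP/cvg_ex; exists u.
apply/cvgrPdist_lt => _ /gt0_complex[eta eta0 ->].
have [U U0 uU] := ge0_complex (normr_ge0 u).
(* makes both eps * U <= 1/2 and 2 * eps * U ^+ 2 < eta *)
pose eps := eta / (2 * (1 + eta) * (1 + U) ^+ 2).
have den0 : 0 < 2 * (1 + eta) * (1 + U) ^+ 2 by rewrite mulr_gt0 ?exprn_gt0 //; lra.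
have eps0 : 0 < eps by rewrite divr_gt0.
have epsE : eps * (2 * (1 + eta) * (1 + U) ^+ 2) = eta by rewrite mulfVK // gt_eqF.
have eU : eps * U <= 2^-1.
  rewrite -(ler_pM2r den0) mulrAC epsE; nra.
have eUU : 2 * eps * U ^+ 2 < eta.
  rewrite -[X in _ < X]epsE; nra.
have /nbhs_normP[d /= d0 dQ] : \forall x \near (0 : V),
    `|Phi (x + g w) - Phi (g w) - 'd Phi (g w) x| <= eps%:C%C * `|x|.
  have /eqaddoP := diff_locally dP.
  move=> /(_ eps%:C%C); rewrite ltcR => /(_ eps0); apply: filterS => x /=.
  by rewrite opprD addrA.
have hw : \forall h \near (0 : R[i]^o), Phi (g (h *: (1 : R[i]^o) + w)) = h *: 1 + w
   /\ `|g w - g (h *: (1 : R[i]^o) + w)| < d.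
  have c : h *: (1 : R[i]^o) + w @[h --> (0 : R[i]^o)] --> w.
    rewrite -[X in _ --> X]add0r -[X in _ --> X + w](scale0r (1 : R[i]^o)).
    apply: (@differentiable_continuous _ R[i]^o R[i]^o 0
      (fun h => h *: (1 : R[i]^o) + w)).
    exact: differentiableD.
  have Q : \forall z \near w, Phi (g z) = z /\ `|g w - g z| < d.
    by apply: filterI => //; move/cvgrPdist_lt : gc; exact.
  exact: (c _ Q).
rewrite near_withinE; move: hw; apply: filterS => h [Pgh lt_d] h0.
move: Pgh lt_d; rewrite -[h *: 1]/(h * 1) mulr1.
set x := g (h + w) - g w => Pgh; rewrite distrC -/x => lt_d.
have := dQ x; rewrite /ball_ /= sub0r normrN => /(_ lt_d).
rewrite subrK Pgh.
have -> : Phi (g w) = w by exact: nbhs_singleton gK.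
(* [E] is the remainder of the linear approximation of [Phi]; continuity of [g] has made [x] small
   enough for the bound by [eps]. *)
rewrite addrK; set E := h - _ => leE.
have Lx : 'd Phi (g w) x = h - E by rewrite /E opprB addrC subrK.
have xE : x = (h - E) *: u by rewrite -Lx -xLu.
have -> : u - h^-1 *: x = (E / h) *: u.
  rewrite xE scalerA mulrBr mulVf // scalerBl scale1r opprB addrC subrK.
  by rewrite mulrC.
(* As x = (h - E) u and |E| <= eps |x|, absorbing E gives |x| <= 2 |h| |u|. *)
have [X X0 xX] := ge0_complex (normr_ge0 x).
have xle : X <= (modulus h + modulus E) * U.
  rewrite -lecR -xX xE normrZ uU -modulusE -rmorphM /= lecR ler_wpM2r //.
  by rewrite -(modulusN E) modulusD.
have EX : modulus E <= eps * X by rewrite modulus_le rmorphM /= -xX.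
have H0 : 0 < modulus h by rewrite modulus_gt0.
rewrite normrZ uU -modulusE -rmorphM /= ltcR modulusM modulusV mulrAC ltr_pdivrMr //.
have X2 : X <= 2 * (modulus h * U).
  have : modulus E * U <= X * 2^-1.
    apply: (@le_trans _ _ (eps * X * U)); first by rewrite ler_wpM2r.
    by rewrite mulrAC mulrC ler_wpM2l.
  by lra.
apply: (@le_lt_trans _ _ (2 * eps * U ^+ 2 * modulus h)); last by rewrite ltr_pM2r.
have : modulus E * U <= eps * X * U by rewrite ler_wpM2r.
have : eps * X * U <= eps * (2 * (modulus h * U)) * U.
  by rewrite ler_wpM2r // ler_wpM2l // ltW.
by nra.
Qed.

(** * Assembling the biholomorphism *)

(** The vector [v] witnesses that the space is nonzero; rescaling it gives at each point a direction
    of derivative 1. *)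
Lemma biholomorphic_disc (R : realType) (V : normedModType R[i]) (v : V)
    (Omega : set V) (Phi : V -> R[i]^o) :
  v <> 0 -> lempert_domain Omega -> universal_set Omega [set Phi] ->
  biholomorphic Omega (disc R).
Proof.
move=> v0 [[oO _ O0] wh tautO carkob] univ.
have [dP PD] : holomorphic_map Omega (disc R) Phi by exact: univ.1.
have sizeE delta : datum_in Omega delta -> nondegenerate delta ->
    (0 < (datum_size (map_datum Phi delta))%:E)%E.
  move=> dO nd; have [C [/= -> [_ ->]]] := univ.2 delta dO nd.
  exact: wh.
have inj x y : Omega x -> Omega y -> Phi x = Phi y -> x = y.
  move=> Ox Oy Pxy; apply: contrapT => xy.
  have := sizeE (Discrete x y) (conj Ox Oy) xy.
  by rewrite /= Pxy /mobius subrr mul0r modulus0 artanh0 ltxx.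
have Dinj x v' : Omega x -> 'D_v' Phi x = 0 -> v' = 0.
  move=> Ox Dv; apply: contrapT => v'0.
  have := sizeE (Infinitesimal x v') Ox v'0.
  by rewrite /= Dv modulus0 mul0r ltxx.
have unitD x : Omega x -> exists u, 'D_u Phi x = 1.
  move=> Ox; have Dv0 : 'D_v Phi x != 0 by apply/eqP => /(Dinj _ _ Ox).
  exists (('D_v Phi x)^-1 *: v); rewrite deriveE; last exact: dP.
  by rewrite linearZ /= -deriveE; [exact: mulVf | exact: dP].
have proper (s : nat -> V) (c : R) : 0 <= c < 1 ->
    (forall j, Omega (s j)) -> (forall j, modulus (Phi (s j)) <= c) ->
    exists2 p, Omega p & cluster (s @ \oo) p.
  exact: proper_cluster.
have onto w : disc R w -> exists2 s, Omega s & Phi s = w.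
  apply: (onto_disc O0 PD) => s0 w0; exact: value_near_value.
have [s0 _] := O0.
(* Outside the disc [g] takes the default value [s0]. *)
have /choice[g gP] : forall z : R[i]^o, exists s, disc R z -> Omega s /\ Phi s = z.
  move=> z; case: (pselect (disc R z)) => [/onto[s Os Ps]|nz]; first by exists s.
  by exists s0 => /nz.
have gO z : disc R z -> Omega (g z) by case/gP.
have Pg z : disc R z -> Phi (g z) = z by case/gP.
exists Phi, g; split=> //; last first.
  by move=> x Ox; apply: inj; rewrite ?Pg //; [exact: gO (PD _ Ox)|exact: PD].
split=> // w wD; have [u Du] := unitD _ (gO _ wD).
apply: inverse_differentiable Du _.
- exact/dP/gO.
- exact: (inverse_continuous dP inj proper gO Pg).
- have : \forall z \near w, disc R z.
    have e0 : 0 < 1 - `|w| by rewrite subr_gt0.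
    apply/nbhs_normP; exists (1 - `|w|) => //= z; rewrite /ball_ /= => wz.
    rewrite /disc /= -[z](subrK w) (le_lt_trans (ler_normD _ _)) //.
    by rewrite distrC -ltrBrDr.
  by apply: filterS => z; exact: Pg.
- by move=> x; exact/Dinj/gO.
Qed.

Theorem theorem2p1 (R : realType) (n : nat) (Omega : set 'rV[R[i]]_n.+1)
    (hOmega : lempert_domain Omega)
    (hPhi : exists Phi : 'rV[R[i]]_n.+1 -> R[i]^o,
        holomorphic_map Omega (disc R) Phi /\ universal_set Omega [set Phi]) :
  biholomorphic Omega (disc R).
Proof.
have [Phi [_ univ]] := hPhi.
apply: (@biholomorphic_disc _ _ (const_mx 1) _ Phi) => //.
by move/matrixP/(_ 0 0)/eqP; rewrite !mxE oner_eq0.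
Qed.
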